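(* Suppose that for each $j=1,\dots,J$ the constant $\tau_j$ satisfies $$\tau_j<\min_{x\in X}\ \max_{1\le k\le K}\ \sup f(x,\tilde\xi_{\pi_k}).$$ Then the distributionally robust mixed bPOE optimization problem $$(\mathrm{P1})\qquad \min_{x\in X}\ \max_{p\in\mathcal P}\ \sum_{j=1}^J\beta_j\min_{a_j\ge0}\mathbb{E}\big[a_j(f(x,\tilde\xi_p)-\tau_j)+1\big]_+$$ is equivalent to the program $$(\mathrm{P2})\qquad \min_{x\in X,\ 0\le a\le\widehat A}\ \ \max_{1\le k\le K}\ \sum_{j=1}^J\beta_j\,\mathbb{E}\big[a_j(f(x,\tilde\xi_{\pi_k})-\tau_j)+1\big]_+ ,$$ in the following sense: if $x$ is an optimal solution of (P1), then there exists $a$ such that $(x,a)$ is an optimal solution of (P2); conversely, if $(x,a)$ is an optimal solution of (P2), then $x$ is an optimal solution of (P1).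
   Context: $X\subseteq\mathbb{R}^n$ is a nonempty compact convex set; $f:\mathbb{R}^n\times\Xi\to\mathbb{R}$, $\Xi\subseteq\mathbb{R}^m$, is a Carathéodory function (continuous in $x$, measurable in $\xi$). $\beta_j\ge0$ and $\tau_j\in\mathbb{R}$, $j=1,\dots,J$, are given; $[t]_+=\max\{t,0\}$. $\{\pi_k\}_{k=1}^K$ are given cumulative distribution functions and $\mathcal P=\{\sum_{k=1}^K\lambda_k\pi_k:\lambda\in\Lambda\}$ is the set of their mixtures, where $\Lambda=\{\lambda\in\mathbb{R}^K:\sum_k\lambda_k=1,\ 0\le\lambda_k\le1\ \forall k\}$. For $p\in\mathcal P$, $\tilde\xi_p:\Omega\to\Xi$ denotes a random variable with cumulative distribution function $p$. For a scalar random variable $Z$, $\sup Z$ denotes its essential supremum. The inner minimum $\min_{a_j\ge0}\mathbb{E}[a_j(Z-\tau_j)+1]_+$ is the buffered probability of exceedance of $Z$ at threshold $\tau_j$. $\widehat A=(\widehat A_1,\dots,\widehat A_J)$ is a vector of positive constants, independent of $x\in X$ and $p\in\mathcal P$, whose existence is deduced under the condition that $\tau_j<\min_{x\in X}\max_{1\le k\le K}\sup f(x,\tilde\xi_{\pi_k})$ for each $j=1,\dots,J$, such that for all $x\in X$, $p\in\mathcal P$ and $j$, $$\min_{a_j\ge0}\mathbb{E}[a_j(f(x,\tilde\xi_p)-\tau_j)+1]_+=\min_{0\le a_j\le\widehat A_j}\mathbb{E}[a_j(f(x,\tilde\xi_p)-\tau_j)+1]_+ .$$ The inequality $0\le a\le\widehat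 A$ is componentwise. *)

(* Defs.v *)
From HB Require Import structures.
From mathcomp Require Import all_boot all_order all_algebra.
From mathcomp Require Import all_classical all_reals all_analysis.
From mathcomp Require Import ess_sup_inf.
Set Implicit Arguments.
Unset Strict Implicit.
Unset Printing Implicit Defensive.
Import Order.TTheory GRing.Theory Num.Theory.
Import numFieldNormedType.Exports.
Local Open Scope classical_set_scope.
Local Open Scope ring_scope.
Local Open Scope ereal_scope.

(* Vectors of decision variables live in 'rV[R]_n, which carries the topology   *)
(* of R^n; values of random vectors live in m.-tuple R, which carries the       *)
(* product sigma-algebra of the Borel sets of R, i.e. the Borel sets of R^m.    *)
(* Minima and maxima of extended-real functions over infinite sets are written  *)
(* ereal_inf and ereal_sup; optimal solutions are points attaining them.        *)

(* Xi need not be a Borel set, so f x is measurable on Xi in the sense of the   *)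
(* trace on Xi of the Borel sets; measurable_fun Xi (f x) would hold vacuously  *)
(* for a non-measurable Xi.                                                     *)
Definition caratheodory (R : realType) (n m : nat) (Xi : set (m.-tuple R))
    (f : 'rV[R]_n -> m.-tuple R -> R) : Prop :=
  (forall u, Xi u -> continuous (fun x => f x u)) /\
  (forall x, preimage_set_system Xi (f x) measurable `<=`
             strace measurable Xi).

Definition is_cdf_of (R : realType) (m : nat)
    (mu : probability (m.-tuple R) R) (F : m.-tuple R -> R) : Prop :=
  forall t : m.-tuple R,
    mu [set u | forall i, (tnth u i <= tnth t i)%R] = (F t)%:E.

Definition is_cdf (R : realType) (m : nat) (F : m.-tuple R -> R) : Prop :=
  exists mu : probability (m.-tuple R) R, is_cdf_of mu F.

Definition simplex (R : realType) (K : nat) : set ('I_K -> R) :=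
  [set lam | (\sum_k lam k = 1)%R /\ forall k, (0 <= lam k <= 1)%R].

Definition mixtures (R : realType) (K m : nat) (pi : 'I_K -> m.-tuple R -> R) :
    set (m.-tuple R -> R) :=
  [set (fun t => \sum_k lam k * pi k t)%R | lam in simplex (K := K)].

(* E[a (Z - tau) + 1]_+ : the positive part is inside the expectation, which    *)
(* is +oo when Z has no finite upper mean and a > 0.                            *)
Definition expected_excess (d : measure_display) (Omega : measurableType d)
    (R : realType) (P : probability Omega R) (Z : Omega -> R) (tau a : R) :
    \bar R :=
  'E_P[((fun w => a * (Z w - tau) + 1)^\+)%R].

Definition bPOE (d : measure_display) (Omega : measurableType d)
    (R : realType) (P : probability Omega R) (Z : Omega -> R) (tau : R) :
    \bar R :=
  ereal_inf [set expected_excess P Z tau a | a in [set a : R | (0 <= a)%R]].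

Definition is_optimal_solution (R : realType) (T : Type) (D : set T)
    (F : T -> \bar R) (z : T) : Prop :=
  D z /\ forall z', D z' -> F z <= F z'.

(* In the two objectives xi p is the random vector with cdf p.                  *)
Definition P1_objective (d : measure_display) (Omega : measurableType d)
    (R : realType) (P : probability Omega R) (n m J K : nat)
    (f : 'rV[R]_n -> m.-tuple R -> R) (pi : 'I_K -> m.-tuple R -> R)
    (xi : (m.-tuple R -> R) -> Omega -> m.-tuple R)
    (beta tau : 'I_J -> R) (x : 'rV[R]_n) : \bar R :=
  ereal_sup [set \sum_(j < J) (beta j)%:E * bPOE P (f x \o xi p) (tau j)
            | p in mixtures pi].

Definition P2_objective (d : measure_display) (Omega : measurableType d)
    (R : realType) (P : probability Omega R) (n m J K : nat)
    (f : 'rV[R]_n -> m.-tuple R -> R) (pi : 'I_K -> m.-tuple R -> R)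
    (xi : (m.-tuple R -> R) -> Omega -> m.-tuple R)
    (beta tau : 'I_J -> R) (xa : 'rV[R]_n * ('I_J -> R)) : \bar R :=
  \big[maxe/-oo]_(k < K) \sum_(j < J)
    (beta j)%:E * expected_excess P (f xa.1 \o xi (pi k)) (tau j) (xa.2 j).

Definition P2_feasible (R : realType) (n J : nat) (X : set 'rV[R]_n)
    (Ahat : 'I_J -> R) : set ('rV[R]_n * ('I_J -> R)) :=
  [set xa | X xa.1 /\ forall j, (0 <= xa.2 j <= Ahat j)%R].

(* Main.v *)
(* For fixed x, the value of (P1) at x is the minimum over the box              *)
(* 0 <= a <= Ahat of the objective of (P2) at (x, a). The expected excess is    *)
(* linear in the mixture, since cdfs determine distributions, so this is a      *)
(* minimax identity between the simplex and the box. If some f(x, xi_(pi_k))    *)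
(* has an infinite positive mean, then a = 0 is optimal on both sides;          *)
(* otherwise the expected excesses are finite, convex and continuous in a, and  *)
(* a theorem of the alternative for convex functions on a compact convex set    *)
(* applies.                                                                     *)
Require Import Defs.
From HB Require Import structures.
From mathcomp Require Import all_boot all_order all_algebra.
From mathcomp Require Import all_classical all_reals all_analysis.
From mathcomp Require Import ess_sup_inf.
From mathcomp Require Import measurable_realfun ring lra.
Set Implicit Arguments.
Unset Strict Implicit.
Unset Printing Implicit Defensive.
Import Order.TTheory GRing.Theory Num.Theory.
Import numFieldNormedType.Exports.
Local Open Scope classical_set_scope.
Local Open Scope ring_scope.
Local Open Scope ereal_scope.

(** Optimal solutions transfer because, for each [x] in [X], the value of [P1_objective] at [x] is
    the minimum of [P2_objective] at [(x, a)] over the box [0 <= a <= Ahat].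

    One inequality is [P1_le_P2]. By [expected_excess_mixture] the expected excess at a mixture is
    the average of those at the [pi k], and an average is at most the maximum.

    The other is [P2_attains_P1]. Let [c] be the value of (P1) at [x], and suppose that no [a] in
    the box brings all [K] vertex objectives down to [c]. Then [convex_alternative] gives weights
    [lam] whose weighted objective exceeds [c] on the whole box. That objective is a sum of
    functions of the separate [a j], so it can be minimised coordinate by coordinate. By the choice
    of [Ahat] these minima bound the bPOEs of the mixture [lam] from below, so (P1) has value above
    [c] at [x], a contradiction. *)

(** * A theorem of the alternative for convex functions *)

(** The squared positive part has the 2-Lipschitz derivative [2 * max(h, 0)]; this is the resulting
    quadratic upper bound. *)
Lemma maxr0_sqrD_le (R : realType) (h e : R) :
  (Num.max (h + e) 0 ^+ 2 <= Num.max h 0 ^+ 2 + 2 * e * Num.max h 0 + e ^+ 2)%R.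
Proof.
by rewrite !maxEle; case: ifPn; case: ifPn; rewrite -?ltNge => ? ?; nra.
Qed.

(** Extracts a first-order optimality condition from increments along a segment. *)
Lemma ge0_of_quadratic_ge0 (R : realType) (u v : R) :
  (forall t, 0 < t -> t <= 1 -> 0 <= 2 * t * u + t ^+ 2 * v)%R -> (0 <= u)%R.
Proof.
move=> H; rewrite leNgt; apply/negP => u0.
have v0 : (0 < v)%R by have := H 1%R ltr01 (lexx _); nra.
(* For this [t], [t * v <= - u], so the quadratic is at most [t * u < 0]. *)
pose t := (Num.min 1 (- u / v))%R.
have uv0 : (0 < - u / v)%R by rewrite divr_gt0 ?oppr_gt0.
have t0 : (0 < t)%R by rewrite lt_min ltr01 uv0.
have t1 : (t <= 1)%R by rewrite ge_min lexx.
have tv : (t * v <= - u)%R by rewrite -ler_pdivlMr// ge_min lexx orbT.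
have := H t t0 t1; nra.
Qed.

(* Minimise the squared violation [\sum_k max(G_k - c, 0)^2]: at a minimiser    *)
(* with positive value the violations are, up to scaling, the multipliers.      *)
Lemma convex_alternative (R : realType) (n K : nat) (A : set 'rV[R]_n)
    (G : 'I_K -> 'rV[R]_n -> R) (c : R) :
  A !=set0 -> compact A -> (forall k, continuous (G k)) ->
  (forall a b t, A a -> A b -> 0 <= t <= 1 -> A ((1 - t) *: a + t *: b))%R ->
  (forall k a b t, A a -> A b -> 0 <= t <= 1 ->
    G k ((1 - t) *: a + t *: b) <= (1 - t) * G k a + t * G k b)%R ->
  (exists2 a, A a & forall k, G k a <= c)%R \/
  (exists2 lam, simplex lam & forall a, A a -> c < \sum_k lam k * G k a)%R.
Proof.
move=> A0 cA cG convA convG.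
pose w k a := (Num.max (G k a - c) 0)%R.
pose Phi a := (\sum_k w k a ^+ 2)%R.
have w_ge0 k a : (0 <= w k a)%R by rewrite le_max lexx orbT.
have cPhi : continuous Phi.
  apply: (continuous_big (op := +%R) (x0 := 0%R)) => [|k _ a].
    exact: add_continuous.
  have cw : {for a, continuous (w k)}.
    apply: (@continuous_max R _ (fun b => G k b - c)%R (cst 0%R)).
      by apply: (@continuousB R R^o _ (G k) (cst c));
        [exact: cG|exact: cst_continuous].
    exact: cst_continuous.
  exact: (continuousM cw cw).
have [a0 /set_mem Aa0 Phi_min] := EVT_min_rV A0 cA (continuous_subspaceT cPhi).
have [Ga0|] := pselect (forall k, G k a0 <= c)%R; first by left; exists a0.
move=> /existsNP[k0 /negP]; rewrite -ltNge => cGk0; right.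
pose W := (\sum_k w k a0)%R.
have wk0 : (0 < w k0 a0)%R by rewrite lt_max subr_gt0 cGk0.
have W0 : (0 < W)%R.
  by rewrite /W (bigD1 k0)//= ltr_pwDl// sumr_ge0.
have key a : A a -> (c * W < \sum_k w k a0 * G k a)%R.
  move=> Aa.
  (* First-order optimality of [a0] towards [a]: convexity replaces [G k] by its chord, and
     [maxr0_sqrD_le] bounds the increment of [Phi] by a quadratic in [t]. *)
  have : (0 <= \sum_k w k a0 * (G k a - G k a0))%R.
    apply: (@ge0_of_quadratic_ge0 _ _ (\sum_k (G k a - G k a0) ^+ 2)%R) => t t0 t1.
    have t01 : (0 <= t <= 1)%R by rewrite ltW.
    have := Phi_min _ (mem_set (convA _ _ _ Aa0 Aa t01)).
    rewrite -subr_ge0 => /le_trans; apply.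
    rewrite /Phi -sumrB !mulr_sumr -big_split/= ler_sum// => k _.
    rewrite lerBlDr.
    have := maxr0_sqrD_le (G k a0 - c) (t * (G k a - G k a0)).
    have : (w k ((1 - t) *: a0 + t *: a) ^+ 2 <=
            Num.max (G k a0 - c + t * (G k a - G k a0)) 0 ^+ 2)%R.
      apply: lerXn2r; rewrite ?nnegrE//; first by rewrite le_max lexx orbT.
      rewrite /w ge_max !le_max lexx !orbT andbT.
      by have := convG k _ _ _ Aa0 Aa t01 => ?; apply/orP; left; lra.
    rewrite -/(w k a0); set p := (_ ^+ 2)%R; set q := (_ ^+ 2)%R; nra.
  (* Where [w k a0] is nonzero it equals [G k a0 - c], so the two sides differ by a sum of squares,
     positive at [k0]. *)
  have wc : (c * W < \sum_k w k a0 * G k a0)%R.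
    rewrite -subr_gt0 /W mulr_sumr -sumrB (bigD1 k0)//= ltr_pwDl//.
      by move: wk0; rewrite /w; case: (leP (G k0 a0 - c)%R 0%R) => ? ?; nra.
    rewrite sumr_ge0// => k _.
    by rewrite /w; case: (leP (G k a0 - c)%R 0%R) => ?; nra.
  move=> H; apply: (lt_le_trans wc); rewrite -subr_ge0 -sumrB.
  by under eq_bigr do rewrite -mulrBr.
exists (fun k => w k a0 / W)%R.
  split; first by rewrite -mulr_suml divff// gt_eqF.
  move=> k; rewrite divr_ge0 ?(ltW W0)//= ler_pdivrMr// mul1r.
  by rewrite /W (bigD1 k)//= lerDl sumr_ge0.
move=> a Aa; under eq_bigr do rewrite mulrAC.
by rewrite -mulr_suml ltr_pdivlMr// key.
Qed.

(** * Expected excess of a mixture *)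

(** For each rational [q] choose a measurable set that cuts out [g > q] on [D]; the supremum of the
    [q] whose set contains [u] is measurable everywhere and recovers [g] on [D]. *)
Lemma strace_measurable_extension (d : measure_display) (T : measurableType d)
    (R : realType) (D : set T) (g : T -> R) :
  preimage_set_system D g measurable `<=` strace measurable D ->
  exists2 h : T -> R, measurable_fun setT h & forall u, D u -> h u = g u.
Proof.
move=> gD.
have /choice[B BP] : forall q : rat, exists B, measurable B /\
    B `&` D = D `&` g @^-1` `]ratr q, +oo[%classic.
  move=> q; have [|B mB BD] := gD (D `&` g @^-1` `]ratr q, +oo[%classic).
    by exists `]ratr q, +oo[%classic.
  by exists B.
(* Indices that code no rational merely repeat [0]. *)
pose q_ (k : nat) : rat := odflt 0%R (unpickle k).
pose h_ k u : \bar R := if u \in B (q_ k) then (ratr (q_ k))%:E else -oo.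
(* The supremum can be infinite only off [D], where [fine] sends it to [0]. *)
exists (fun u => fine (esups (h_ ^~ u) 0%N)).
  have mh : measurable_fun setT (fun u => esups (h_ ^~ u) 0%N); last first.
    exact: (measurableT_comp (fine_measurable measurableT) mh).
  apply: (measurable_fun_esups (f := h_)) => k.
  apply: measurable_fun_ifT => //.
  apply: (measurable_fun_bool true); rewrite setTI.
  rewrite (_ : _ @^-1` _ = B (q_ k)); first exact: (BP _).1.
  by apply/seteqP; split=> u /=; [exact: set_mem|exact: mem_set].
move=> u Du; rewrite (_ : esups _ _ = (g u)%:E)//; apply/eqP.
have Bq q : u \in B q = (ratr q < g u)%R.
  have [_ /seteqP[BD DB]] := BP q; apply/idP/idP => [/set_mem Bu|qg].
    by have [_] := BD u (conj Bu Du); rewrite /= in_itv/= andbT.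
  by apply/mem_set; have [] := DB u; rewrite //= in_itv/= andbT.
rewrite eq_le; apply/andP; split.
  apply: ge_ereal_sup => _ [k _ <-]; rewrite /h_ Bq.
  case: ifPn => [qg|_]; last exact: leNye.
  by rewrite lee_fin ltW.
apply/lee_subgt0Pr => e e0.
have [q /itvP qP] : exists q : rat, ratr q \in `]g u - e, g u[%R.
  by apply: rat_in_itvoo; rewrite ltrBlDr ltrDl.
apply: (@le_trans _ _ (ratr q)%:E); first by rewrite lee_fin qP.
apply: ereal_sup_ubound; exists (pickle q) => //.
by rewrite /h_ /q_ pickleK/= Bq qP.
Qed.

(** The pi-system on which a cdf prescribes the measure. *)
Definition orthants (R : realType) (m : nat) : set (set (m.-tuple R)) :=
  [set [set u : m.-tuple R | forall i, (tnth u i <= tnth t i)%R]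
  | t in [set: m.-tuple R]].

Lemma orthants_measurable (R : realType) (m : nat) :
  @orthants R m `<=` measurable.
Proof.
move=> _ [t _ <-].
rewrite (_ : mkset _ = \bigcap_(i in [set: 'I_m])
    ((@tnth m R)^~ i @^-1` `]-oo, tnth t i]%classic)).
  apply: fin_bigcap_measurable => // i _; rewrite -[X in measurable X]setTI.
  by apply: measurable_tnth.
apply/seteqP; split=> u /= ut i => [_|]; last first.
  by have := ut i I; rewrite /= in_itv.
by rewrite /= in_itv/= ut.
Qed.

Lemma orthants_setI_closed (R : realType) (m : nat) :
  setI_closed (@orthants R m).
Proof.
move=> _ _ [s _ <-] [t _ <-].
exists [tuple Num.min (tnth s i) (tnth t i) | i < m] => //.
apply/seteqP; split=> [u /= H|u /= [us ut] i].
  by split=> i; have := H i; rewrite tnth_mktuple le_min => /andP[].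
by rewrite tnth_mktuple le_min us ut.
Qed.

Lemma orthants_cover (R : realType) (m : nat) :
  \bigcup_N [set u : m.-tuple R |
    forall i, (tnth u i <= tnth [tuple N%:R | _ < m] i)%R] = setT.
Proof.
apply/seteqP; split=> // u _.
exists (\max_(i < m) Num.trunc `|tnth u i|).+1 => // i.
rewrite tnth_mktuple (le_trans (ler_norm _))// ltW//.
rewrite (lt_le_trans (truncnS_gt _))// ler_nat ltnS.
exact: (leq_bigmax (F := fun i => Num.trunc `|tnth u i|)).
Qed.

Lemma orthants_generate (R : realType) (m : nat) :
  (measurable : set (set (m.-tuple R))) `<=` <<s @orthants R m >>.
Proof.
apply: smallest_sub; first exact: smallest_sigma_algebra.
apply: (big_ind (fun C => C `<=` <<s @orthants R m >>)).
- by [].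
- by move=> A B sA sB; rewrite subUset.
move=> i _ _ [B mB <-].
suff : measurable_fun setT
    ((@tnth m R)^~ i : g_sigma_algebraType (@orthants R m) -> R).
  by move=> /(_ measurableT B mB).
apply: (measurability _ (RGenOInfty.measurableE R)) => _ [_ [x ->] <-].
(* The half-space where coordinate [i] is at most [x] is the countable union of orthants with corner
   [x] at [i] and [N] elsewhere. *)
rewrite setTI (_ : _ @^-1` _ = ~` \bigcup_N [set u : m.-tuple R | forall j,
    tnth u j <= tnth [tuple if k == i then x else N%:R | k < m] j])%R.
  apply: measurableC; apply: bigcup_measurable => N _.
  by apply: sub_sigma_algebra; eexists.
apply/seteqP; split=> [u /= xu [N _ /(_ i)]|u /= H].
  by rewrite tnth_mktuple eqxx leNgt; move: xu; rewrite in_itv/= andbT => ->.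
rewrite in_itv/= andbT ltNge; apply/negP => ux; apply: H.
have [N _ uN] : (\bigcup_N [set u : m.-tuple R |
    forall i, tnth u i <= tnth [tuple N%:R | _ < m] i])%R u.
  by rewrite orthants_cover.
exists N => // j; rewrite tnth_mktuple; case: eqP => [->//|_].
by have := uN j; rewrite tnth_mktuple.
Qed.

(** [mu] and the weighted sum of the [nu k] agree on orthants, hence on all measurable sets by
    uniqueness on a generating pi-system. *)
Lemma integral_cdf_mixture (R : realType) (m K : nat) (lam : 'I_K -> R)
    (pi : 'I_K -> m.-tuple R -> R) (mu : probability (m.-tuple R) R)
    (nu : 'I_K -> probability (m.-tuple R) R) (h : m.-tuple R -> \bar R) :
  (forall k, 0 <= lam k)%R ->
  (forall k, is_cdf_of (nu k) (pi k)) ->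
  is_cdf_of mu (fun t => \sum_k lam k * pi k t)%R ->
  measurable_fun setT h -> (forall u, 0 <= h u) ->
  \int[mu]_u h u = \sum_k (lam k)%:E * \int[nu k]_u h u.
Proof.
move=> lam0 nuP muP mh h0.
pose m_ (i : nat) : {measure set (m.-tuple R) -> \bar R} :=
  if insub i is Some k then mscale (NngNum (lam0 k)) (nu k) else mzero.
have m_E (k : 'I_K) : m_ k = mscale (NngNum (lam0 k)) (nu k).
  by rewrite /m_ valK.
rewrite (eq_measure_integral (msum m_ K)).
  rewrite ge0_integral_measure_sum//; apply: eq_bigr => k _.
  by rewrite m_E ge0_integral_mscale.
move=> A mA _.
apply: (@g_sigma_algebra_measure_unique _ _ _ (@orthants R m)
  (@orthants_measurable R m) (fun N => [set u : m.-tuple R |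
    forall i, (tnth u i <= tnth [tuple N%:R | _ < m] i)%R])).
- by move=> N; eexists.
- exact: orthants_cover.
- exact: orthants_setI_closed.
- move=> _ [t _ <-]; rewrite [LHS]muP /msum -sumEFin; apply: eq_bigr => k _.
  by rewrite m_E EFinM -(nuP k t).
- by move=> N; rewrite [ltLHS]muP ltry.
- exact: orthants_generate.
Qed.

(** All the random vectors take values in [Xi], so [g] may be replaced by a Borel extension and the
    expectations become integrals against the distributions. *)
Lemma expected_excess_mixture (R : realType) (d : measure_display)
    (Omega : measurableType d) (P : probability Omega R) (m K : nat)
    (Xi : set (m.-tuple R)) (g : m.-tuple R -> R)
    (pi : 'I_K -> m.-tuple R -> R) (lam : 'I_K -> R)
    (X : {RV P >-> m.-tuple R}) (Y : 'I_K -> {RV P >-> m.-tuple R})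
    (tau a : R) :
  preimage_set_system Xi g measurable `<=` strace measurable Xi ->
  (forall w, Xi (X w)) -> (forall k w, Xi (Y k w)) ->
  (forall k, 0 <= lam k)%R ->
  (forall k, is_cdf_of (distribution P (Y k)) (pi k)) ->
  is_cdf_of (distribution P X) (fun t => \sum_k lam k * pi k t)%R ->
  expected_excess P (g \o X) tau a =
  \sum_k (lam k)%:E * expected_excess P (g \o Y k) tau a.
Proof.
move=> /strace_measurable_extension[h mh hg] XiX XiY lam0 Ycdf Xcdf.
pose phi u : \bar R := (Num.max (a * (h u - tau) + 1) 0)%:E.
have mphi : measurable_fun setT phi.
  apply/measurable_EFinP; apply: measurable_maxr => //.
  apply: measurable_funD => //; apply: measurable_funM => //.
  exact: measurable_funB.
have phi0 u : 0 <= phi u by rewrite lee_fin le_max lexx orbT.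
have excessE (Z : {RV P >-> m.-tuple R}) : (forall w, Xi (Z w)) ->
    expected_excess P (g \o Z) tau a = \int[distribution P Z]_u phi u.
  move=> XiZ; rewrite ge0_integral_distribution// /expected_excess unlock.
  by apply: eq_integral => w _; rewrite /phi/= hg.
rewrite excessE// (integral_cdf_mixture lam0 Ycdf Xcdf)//.
by apply: eq_bigr => k _; rewrite excessE.
Qed.

(** * The expected excess as a function of [a] *)

Section expected_excess_theory.
Context (d : measure_display) (Omega : measurableType d) (R : realType).
Context (P : probability Omega R) (Z : Omega -> R) (tau : R).

Lemma expected_excessE (a : R) :
  expected_excess P Z tau a =
  \int[P]_w (Num.max (a * (Z w - tau) + 1) 0)%:E.
Proof. by rewrite /expected_excess unlock. Qed.

Lemma expected_excess_ge0 (a : R) : 0 <= expected_excess P Z tau a.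
Proof.
by rewrite expected_excessE integral_ge0// => w _; rewrite lee_fin le_max lexx orbT.
Qed.

Lemma expected_excess0 : expected_excess P Z tau 0 = 1.
Proof.
rewrite expected_excessE.
under eq_integral do rewrite mul0r add0r max_l//.
rewrite integral_cst// mul1e. exact: probability_setT.
Qed.

Hypothesis mZ : measurable_fun setT Z.

Let mexcess (a : R) :
  measurable_fun setT (fun w => (Num.max (a * (Z w - tau) + 1) 0)%:E).
Proof.
apply/measurable_EFinP; apply: measurable_maxr => //.
apply: measurable_funD => //; apply: measurable_funM => //.
exact: measurable_funB.
Qed.

Let mpos : measurable_fun setT (fun w => (Num.max (Z w) 0)%:E).
Proof. by apply/measurable_EFinP; exact: measurable_maxr. Qed.

Lemma expected_excess_pinfty (a : R) : (0 < a)%R ->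
  \int[P]_w (Num.max (Z w) 0)%:E = +oo -> expected_excess P Z tau a = +oo.
Proof.
move=> a0 Zoo; apply/eqP; rewrite -leye_eq.
(* Pointwise, [a * max(Z, 0)] exceeds the excess by at most [|a * tau - 1|]. *)
have ae : a%:E * \int[P]_w (Num.max (Z w) 0)%:E <=
    expected_excess P Z tau a + `|a * tau - 1|%:E.
  rewrite expected_excessE.
  rewrite -[X in _ + X]mule1 -(@probability_setT _ _ _ P).
  rewrite -integral_cst// -ge0_integralZl ?lee_fin ?(ltW a0)//; last first.
    by move=> w _; rewrite lee_fin le_max lexx orbT.
  rewrite -ge0_integralD//; last 2 first.
  - by move=> w _; rewrite lee_fin le_max lexx orbT.
  - by move=> w _; rewrite lee_fin.
  apply: ge0_le_integral => //.
  - by move=> w _; rewrite mule_ge0 ?lee_fin ?(ltW a0)// le_max lexx orbT.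
  - exact: measurable_funeM.
  - exact: emeasurable_funD.
  - move=> w _; rewrite -EFinM -EFinD lee_fin.
    have := ler_norm (a * tau - 1)%R; have := normr_ge0 (a * tau - 1)%R.
    rewrite !maxEle; case: ifPn; case: ifPn; rewrite -?ltNge; nra.
move: ae; rewrite Zoo gt0_muley ?lte_fin// leye_eq => /eqP.
by case: expected_excess.
Qed.

Hypothesis Zfin : \int[P]_w (Num.max (Z w) 0)%:E < +oo.

(** An integrable function dominating the excesses at [|a|] for all [|a| <= M] at once. *)
Let bound (M : R) (w : Omega) := (M * Num.max (Z w) 0 + (M * `|tau| + 1))%R.

Let integrable_bound (M : R) : P.-integrable setT (EFin \o bound M).
Proof.
rewrite /bound (_ : _ \o _ = (fun w => M%:E * (Num.max (Z w) 0)%:E) \+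
  cst (M * `|tau| + 1)%:E)//.
apply: integrableD => //.
  apply: integrableZl => //; apply/integrableP; split => //.
  under eq_integral do rewrite gee0_abs ?lee_fin ?le_max ?lexx ?orbT//.
  exact: Zfin.
exact: finite_measure_integrable_cst.
Qed.

Let excess_le_bound (a M : R) (w : Omega) : (`|a| <= M)%R ->
  (`|Num.max (`|a| * (Z w - tau) + 1) 0| <= bound M w)%R.
Proof.
rewrite /bound => aM; have := normr_ge0 a; have := normr_ge0 tau.
have := ler_norm (- tau)%R; rewrite normrN => t0 t1 a0.
rewrite ger0_norm ?le_max ?lexx ?orbT//.
have : (0 <= (M - `|a|) * `|tau|)%R by apply: mulr_ge0 => //; lra.
have : (0 <= `|a| * (`|tau| + tau))%R by apply: mulr_ge0 => //; lra.
by rewrite !maxEle; case: ifPn; case: ifPn; rewrite -?ltNge; nra.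
Qed.

Lemma integrable_excess (a : R) :
  P.-integrable setT (fun w => (Num.max (`|a| * (Z w - tau) + 1) 0)%:E).
Proof.
apply: (le_integrable measurableT _ _ (integrable_bound `|a|%R)) => //.
move=> w _ /=; rewrite lee_fin.
by rewrite (le_trans (excess_le_bound w (lexx `|a|%R)))// ler_norm.
Qed.

Lemma expected_excess_fin_num (a : R) : (0 <= a)%R ->
  expected_excess P Z tau a \is a fin_num.
Proof.
move=> a0; rewrite expected_excessE.
have := integrable_excess a; rewrite ger0_norm//.
exact: integrable_fin_num.
Qed.

(* The absolute value makes this a total function: for a < 0 the excess may     *)
(* have infinite expectation.                                                   *)
Lemma continuous_expected_excess :
  continuous (fun a : R => fine (expected_excess P Z tau `|a|%R)).
Proof.
pose F (b : R) w := (Num.max (`|b| * (Z w - tau) + 1) 0)%R.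
rewrite (_ : (fun a => _) = fun b => \int[P]_w F b w)%R; last first.
  by apply/funext => b; rewrite expected_excessE.
move=> a; have aI : a \in (`](a - 1)%R, (a + 1)%R[%classic : set R).
  by rewrite inE/= in_itv/=; apply/andP; split; lra.
(* Domination on a neighbourhood of [a] of radius 1, where [|b| <= |a| + 1]. *)
apply: (@continuity_under_integral _ _ _ P F setT measurableT
  (a - 1)%R (a + 1)%R _ _ (bound (`|a| + 1)%R) _ _ a aI) => //.
- by move=> b _; exact: integrable_excess.
- apply: aeW => w _ b _.
  apply: (@continuous_max R _ (fun c => `|c| * (Z w - tau) + 1)%R (cst 0%R)).
    apply: (@continuousD R R^o _ (fun c => `|c| * (Z w - tau))%R (cst 1%R)).
      apply: (@continuousM R R^o (fun c => `|c|)%R (cst (Z w - tau))%R).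
        exact: norm_continuous.
      exact: cst_continuous.
    exact: cst_continuous.
  exact: cst_continuous.
- move=> b; rewrite /= in_itv/= => /andP[b1 b2]; apply: aeW => w _.
  apply: excess_le_bound; rewrite ler_norml.
  by have := ler_norm a; have := ler_norm (- a)%R; rewrite normrN; lra.
Qed.

Lemma convex_expected_excess (a b t : R) :
  (0 <= a)%R -> (0 <= b)%R -> (0 <= t <= 1)%R ->
  (fine (expected_excess P Z tau ((1 - t) * a + t * b)) <=
   (1 - t) * fine (expected_excess P Z tau a) +
   t * fine (expected_excess P Z tau b))%R.
Proof.
move=> a0 b0 /andP[t0 t1].
have c0 : (0 <= (1 - t) * a + t * b)%R by nra.
rewrite -lee_fin EFinD !EFinM !fineK ?expected_excess_fin_num//.
rewrite !expected_excessE.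
rewrite -!ge0_integralZl ?lee_fin ?subr_ge0//; last 2 first.
- by move=> w _; rewrite lee_fin le_max lexx orbT.
- by move=> w _; rewrite lee_fin le_max lexx orbT.
rewrite -ge0_integralD//; last 4 first.
- by move=> w _; rewrite mule_ge0// lee_fin ?subr_ge0// le_max lexx orbT.
- exact: measurable_funeM.
- by move=> w _; rewrite mule_ge0// lee_fin ?subr_ge0// le_max lexx orbT.
- exact: measurable_funeM.
apply: ge0_le_integral => //.
- by move=> w _; rewrite lee_fin le_max lexx orbT.
- by apply: emeasurable_funD; exact: measurable_funeM.
- move=> w _; rewrite -!EFinM -EFinD lee_fin.
  set z := (Z w - tau)%R; rewrite ge_max.
  have : (a * z + 1 <= Num.max (a * z + 1) 0)%R by rewrite le_max lexx.
  have : (b * z + 1 <= Num.max (b * z + 1) 0)%R by rewrite le_max lexx.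
  have : (0 <= Num.max (a * z + 1) 0)%R by rewrite le_max lexx orbT.
  have : (0 <= Num.max (b * z + 1) 0)%R by rewrite le_max lexx orbT.
  move: (Num.max (b * z + 1) 0)%R (Num.max (a * z + 1) 0)%R => p q *.
  by apply/andP; split; nra.
Qed.

End expected_excess_theory.

(** * The minimax identity at a fixed [x] *)

Lemma mixtures_vertex (R : realType) (K m : nat)
    (pi : 'I_K -> m.-tuple R -> R) (k : 'I_K) : mixtures pi (pi k).
Proof.
exists (fun i => (i == k)%:R).
  split; last by move=> i; case: eqP; rewrite ?lexx ?ler01.
  by rewrite (bigD1 k)//= eqxx big1 ?addr0// => i /negPf ->.
apply/funext => t; rewrite (bigD1 k)//= eqxx mul1r big1 ?addr0// => i /negPf ->.
by rewrite mul0r.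
Qed.

Lemma strace_comp_measurable (d d' : measure_display) (T : measurableType d)
    (T' : measurableType d') (R : realType) (D : set T') (g : T' -> R)
    (X : T -> T') :
  preimage_set_system D g measurable `<=` strace measurable D ->
  measurable_fun setT X -> (forall w, D (X w)) -> measurable_fun setT (g \o X).
Proof.
move=> /strace_measurable_extension[h mh hg] mX DX.
rewrite (_ : g \o X = h \o X); first exact: measurableT_comp.
by apply/funext => w /=; rewrite hg.
Qed.

Section bPOE_minimax.
Context (R : realType) (d : measure_display) (Omega : measurableType d).
Context (P : probability Omega R) (n m J K : nat).
Context (Xi : set (m.-tuple R)) (f : 'rV[R]_n -> m.-tuple R -> R).
Context (f_caratheodory : caratheodory Xi f).
Context (beta tau : 'I_J -> R) (beta_ge0 : forall j, (0 <= beta j)%R).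
Context (pi : 'I_K -> m.-tuple R -> R).
Context (xi : (m.-tuple R -> R) -> {RV P >-> m.-tuple R}).
Context (xi_Xi : forall p, mixtures pi p -> forall w, Xi (xi p w)).
Context (xi_cdf : forall p, mixtures pi p -> is_cdf_of (distribution P (xi p)) p).
Context (x : 'rV[R]_n).

Let e k j a := expected_excess P (f x \o xi (pi k)) (tau j) a.
Let mix (lam : 'I_K -> R) t := (\sum_k lam k * pi k t)%R.

Let e_ge0 k j a : 0 <= e k j a.
Proof. exact: expected_excess_ge0. Qed.

Let mf k : measurable_fun setT (f x \o xi (pi k)).
Proof.
apply: (strace_comp_measurable (f_caratheodory.2 x)) => //.
exact/xi_Xi/mixtures_vertex.
Qed.

Lemma expected_excess_mixtures (lam : 'I_K -> R) (t a : R) : simplex lam ->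
  expected_excess P (f x \o xi (mix lam)) t a =
  \sum_k (lam k)%:E * expected_excess P (f x \o xi (pi k)) t a.
Proof.
move=> lamS; have mlam : mixtures pi (mix lam) by exists lam.
apply: (expected_excess_mixture _ _ (f_caratheodory.2 x)).
- exact: xi_Xi.
- by move=> k; apply/xi_Xi/mixtures_vertex.
- by move=> k; have /andP[] := lamS.2 k.
- by move=> k; apply/xi_cdf/mixtures_vertex.
- exact: xi_cdf.
Qed.

Lemma P1_le_P2 (a : 'I_J -> R) : (forall j, 0 <= a j)%R ->
  P1_objective P f pi xi beta tau x <= P2_objective P f pi xi beta tau (x, a).
Proof.
move=> a0; apply: ge_ereal_sup => _ [_ [lam lamS <-] <-].
have lam0 k : 0 <= (lam k)%:E by rewrite lee_fin; have /andP[] := lamS.2 k.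
apply: (@le_trans _ _ (\sum_k (lam k)%:E * \sum_j (beta j)%:E * e k j (a j))).
  have distr k : (lam k)%:E * \sum_j (beta j)%:E * e k j (a j) =
      \sum_j (lam k)%:E * ((beta j)%:E * e k j (a j)).
    by rewrite ge0_sume_distrr// => j _; rewrite mule_ge0 ?lee_fin.
  under [leRHS]eq_bigr do rewrite distr.
  rewrite exchange_big/=; apply: lee_sum => j _.
  under eq_bigr do rewrite muleCA.
  rewrite -ge0_sume_distrr => [|k _]; last exact: mule_ge0.
  apply: lee_wpmul2l; first by rewrite lee_fin.
  rewrite -expected_excess_mixtures//.
  by apply: ereal_inf_lbound; exists (a j); rewrite //=.
rewrite -[leRHS]mul1e -lamS.1 -sumEFin ge0_sume_distrl//.
apply: lee_sum => k _; apply: lee_wpmul2l => //.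
exact: (le_bigmax _ (fun k => \sum_j (beta j)%:E * e k j (a j))).
Qed.

Lemma P2_attains_P1 (Ahat : 'I_J -> R) : (0 < K)%N -> (forall j, 0 <= Ahat j)%R ->
  (forall p j, mixtures pi p -> bPOE P (f x \o xi p) (tau j) =
    ereal_inf [set expected_excess P (f x \o xi p) (tau j) a
              | a in [set a : R | (0 <= a <= Ahat j)%R]]) ->
  exists2 a : 'I_J -> R, (forall j, 0 <= a j <= Ahat j)%R &
    P2_objective P f pi xi beta tau (x, a) <= P1_objective P f pi xi beta tau x.
Proof.
move=> K_gt0 Ahat0 bPOE_Ahat.
have P2_0 : P2_objective P f pi xi beta tau (x, cst 0%R) <=
    (\sum_j beta j)%R%:E.
  apply: bigmax_le; first exact: leNye.
  move=> k _; rewrite -sumEFin; apply: lee_sum => j _.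
  by rewrite expected_excess0 mule1.
have P1_ge p : mixtures pi p ->
    \sum_j (beta j)%:E * bPOE P (f x \o xi p) (tau j) <=
    P1_objective P f pi xi beta tau x.
  by move=> mp; apply: ereal_sup_ubound; exists p.
have bPOE_ge0 p j : 0 <= bPOE P (f x \o xi p) (tau j).
  by apply: le_ereal_inf_tmp => _ [a _ <-]; exact: expected_excess_ge0.
(* If some vertex has infinite positive mean, every [a > 0] has infinite excess there, so its bPOEs
   are at least 1 and [a = 0] already suffices. *)
have [[k kpinfty]|pos_fin] := pselect (exists k,
    \int[P]_w (Num.max ((f x \o xi (pi k)) w) 0)%:E = +oo).
  exists (cst 0%R) => [j|]; first by rewrite /= lexx Ahat0.
  apply: (le_trans P2_0); apply: le_trans (P1_ge _ (mixtures_vertex pi k)).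
  rewrite -sumEFin; apply: lee_sum => j _.
  rewrite -[leLHS]mule1; apply: lee_wpmul2l; first by rewrite lee_fin.
  apply: le_ereal_inf_tmp => _ [a /= a0 <-].
  have [<-|a_neq0] := eqVneq 0%R a; first by rewrite expected_excess0.
  by rewrite (expected_excess_pinfty _ (mf k)) ?leey// lt_neqAle a_neq0.
have {}pos_fin k : \int[P]_w (Num.max ((f x \o xi (pi k)) w) 0)%:E < +oo.
  by rewrite ltey; apply/eqP => H; apply: pos_fin; exists k.
pose phi k j (a : R) := fine (e k j `|a|%R).
have eE k j a : (0 <= a)%R -> e k j a = (phi k j a)%:E.
  by move=> a0; rewrite /phi ger0_norm// fineK// expected_excess_fin_num.
have cphi k j : continuous (phi k j) by exact: continuous_expected_excess.
pose G k (v : 'rV[R]_J) := (\sum_j beta j * phi k j (v ord0 j))%R.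
pose A := [set v : 'rV[R]_J | forall j, `[0%R, Ahat j]%classic (v ord0 j)].
have AP v : A v <-> forall j, (0 <= v ord0 j <= Ahat j)%R.
  by split=> + j => /(_ j); rewrite /= in_itv.
have GE k (v : 'rV[R]_J) : A v ->
    \sum_j (beta j)%:E * e k j (v ord0 j) = (G k v)%:E.
  move=> /AP Av; rewrite -sumEFin; apply: eq_bigr => j _.
  by have /andP[v0 _] := Av j; rewrite eE// EFinM.
(* Finiteness lets the value of (P1) serve as the real level [c] of the alternative. *)
have P1_fin : P1_objective P f pi xi beta tau x \is a fin_num.
  rewrite ge0_fin_numE.
    by apply: le_lt_trans (le_lt_trans P2_0 (ltry _)); exact: P1_le_P2.
  apply: le_trans (P1_ge _ (mixtures_vertex pi (Ordinal K_gt0))).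
  by apply: sume_ge0 => j _; rewrite mule_ge0 ?lee_fin.
have [||||||] := @convex_alternative R J K A G
  (fine (P1_objective P f pi xi beta tau x)).
- exists 0%R; apply/AP => j.
  by rewrite mxE lexx Ahat0.
- apply: (@rV_compact R J (fun j => `[0%R, Ahat j]%classic)) => j.
  exact: segment_compact.
- move=> k; apply: (continuous_big (op := +%R) (x0 := 0%R)) => [|j _ v].
    exact: add_continuous.
  apply: (@continuousM R _ (cst (beta j)) (fun v : 'rV[R]_J => phi k j (v ord0 j))).
    exact: cst_continuous.
  apply: (@continuous_comp _ _ _ (fun v : 'rV[R]_J => v ord0 j) (phi k j)).
    exact: coord_continuous.
  exact: cphi.
- move=> a b t /AP Aa /AP Ab /andP[t0 t1]; apply/AP => j; rewrite !mxE.
  have /andP[a0 aA] := Aa j; have /andP[b0 bA] := Ab j.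
  by apply/andP; split; nra.
- move=> k a b t /AP Aa /AP Ab t01.
  rewrite /G !mulr_sumr -big_split/=; apply: ler_sum => j _; rewrite !mxE.
  have /andP[a0 _] := Aa j; have /andP[b0 _] := Ab j.
  rewrite !(mulrCA _ (beta j)) -mulrDr; apply: ler_wpM2l => //.
  have [t0 t1] := andP t01; rewrite /phi !ger0_norm//; last by nra.
  exact: convex_expected_excess.
- move=> [a Aa Ga]; exists (fun j => a ord0 j); first exact/AP.
  apply: bigmax_le => [|k _]; first exact: leNye.
  by rewrite [leLHS]GE// -(fineK P1_fin) lee_fin.
(* The mixture with weights [lam] will have a (P1) objective above the supremum. Its excess for
   index [j] is [psi j], minimised over [[0, Ahat j]] at [al j]; the point [al] lies in the box, so
   [lamG] applies to it. *)
move=> [lam lamS lamG]; exfalso.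
pose psi j a := (\sum_k lam k * phi k j a)%R.
have /choice[al alP] : forall j, exists a, (0 <= a <= Ahat j)%R /\
    forall b, (0 <= b <= Ahat j)%R -> (psi j a <= psi j b)%R.
  move=> j; have cpsi : continuous (psi j).
    apply: (continuous_big (op := +%R) (x0 := 0%R)) => [|k _ a].
      exact: add_continuous.
    apply: (@continuousM R _ (cst (lam k)) (phi k j)); last exact: cphi.
    exact: cst_continuous.
  have [a aI amin] := EVT_min (Ahat0 j) (continuous_subspaceT cpsi).
  exists a; split; first by move: aI; rewrite in_itv.
  by move=> b bI; apply: amin; rewrite in_itv.
have Aal : A (\row_j al j) by apply/AP => j; rewrite mxE; have [] := alP j.
have := P1_ge (mix lam) (ex_intro2 _ _ lam lamS erefl).
apply/negP; rewrite -ltNge.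
apply: (@lt_le_trans _ _ (\sum_j beta j * psi j (al j))%R%:E).
  rewrite -(fineK P1_fin) lte_fin; apply: (lt_le_trans (lamG _ Aal)).
  rewrite /G /psi; under eq_bigr do rewrite mulr_sumr.
  rewrite exchange_big/=; apply: ler_sum => j _; rewrite mulr_sumr.
  by apply: ler_sum => k _; rewrite mxE mulrCA.
rewrite -sumEFin; apply: lee_sum => j _; rewrite EFinM.
apply: lee_wpmul2l; first by rewrite lee_fin.
rewrite bPOE_Ahat; last by exists lam.
apply: le_ereal_inf_tmp => _ [b /= bI <-].
rewrite expected_excess_mixtures//.
have [_ /(_ b bI) aMin] := alP j.
apply: (@le_trans _ _ (psi j b)%:E); first by rewrite lee_fin.
rewrite /psi -sumEFin; apply: lee_sum => k _.
by rewrite EFinM -eE//; have /andP[] := bI.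
Qed.

End bPOE_minimax.

(** * Transfer of optimal solutions *)

Theorem proposition20 (R : realType) (d : measure_display)
    (Omega : measurableType d) (P : probability Omega R)
    (n m J K : nat) (hK : (0 < K)%N)
    (X : set 'rV[R]_n) (X_nonempty : X !=set0) (X_compact : compact X)
    (X_convex : convex_set (X : set (convex_lmodType 'rV[R]_n)))
    (Xi : set (m.-tuple R)) (f : 'rV[R]_n -> m.-tuple R -> R)
    (f_caratheodory : caratheodory Xi f)
    (beta tau : 'I_J -> R) (beta_ge0 : forall j, (0 <= beta j)%R)
    (pi : 'I_K -> m.-tuple R -> R) (pi_cdf : forall k, is_cdf (pi k))
    (xi : (m.-tuple R -> R) -> {RV P >-> m.-tuple R})
    (xi_Xi : forall p, mixtures pi p -> forall w, Xi (xi p w))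
    (xi_cdf : forall p, mixtures pi p -> is_cdf_of (distribution P (xi p)) p)
    (Ahat : 'I_J -> R) (Ahat_gt0 : forall j, (0 < Ahat j)%R)
    (Ahat_bound : forall x p j, X x -> mixtures pi p ->
       bPOE P (f x \o xi p) (tau j) =
       ereal_inf [set expected_excess P (f x \o xi p) (tau j) a
                 | a in [set a : R | (0 <= a <= Ahat j)%R]])
    (tau_lt : forall j, (tau j)%:E <
       ereal_inf [set \big[maxe/-oo]_(k < K)
                        ess_sup P (fun w => (f x (xi (pi k) w))%:E) | x in X]) :
  (forall x : 'rV[R]_n,
     is_optimal_solution X (P1_objective P f pi xi beta tau) x ->
     exists a : 'I_J -> R,
       is_optimal_solution (P2_feasible X Ahat)
         (P2_objective P f pi xi beta tau) (x, a)) /\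
  (forall (x : 'rV[R]_n) (a : 'I_J -> R),
     is_optimal_solution (P2_feasible X Ahat)
       (P2_objective P f pi xi beta tau) (x, a) ->
     is_optimal_solution X (P1_objective P f pi xi beta tau) x).
Proof.
have weak y a : P2_feasible X Ahat (y, a) ->
    P1_objective P f pi xi beta tau y <= P2_objective P f pi xi beta tau (y, a).
  move=> [_ /= aA]; apply: (P1_le_P2 f_caratheodory tau beta_ge0 xi_Xi xi_cdf) => j.
  by have /andP[] := aA j.
have attained y : X y -> exists2 a, P2_feasible X Ahat (y, a) &
    P2_objective P f pi xi beta tau (y, a) <= P1_objective P f pi xi beta tau y.
  move=> Xy; have [|p j mp|a aA a_le] :=
    P2_attains_P1 f_caratheodory beta_ge0 xi_Xi xi_cdf
      (x := y) (tau := tau) (Ahat := Ahat) hK.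
  - by move=> j; rewrite ltW.
  - exact: Ahat_bound.
  - by exists a.
split=> [x [Xx xmin]|x a [xaF xamin]].
  have [a aF a_le] := attained x Xx; exists a; split=> // -[y b] ybF.
  by apply: (le_trans a_le); apply: (le_trans (xmin y ybF.1)); exact: weak.
split=> [|y Xy]; first exact: xaF.1.
have [b ybF b_le] := attained y Xy.
by apply: le_trans b_le; apply: le_trans (xamin _ ybF); exact: weak.
Qed.
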